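(* Assume GCH. Let $X$ be a power-homogeneous compactum. Then $dis(X) \geq \min\{\Delta(X), \aleph_\omega\}$.
   Context: A compactum is a compact Hausdorff space. A space $X$ is power homogeneous if $X^\kappa$ (with the product topology) is homogeneous for some cardinal $\kappa$, where a space is homogeneous if any point can be taken to any other point by a self-homeomorphism. $dis(X)$ denotes the least number of discrete sets required to cover $X$ (a subset of $X$ is discrete if its subspace topology is discrete; it need not be closed in $X$). $\Delta(X)$ denotes the least cardinality of a nonempty open subset of $X$ (for nonempty $X$). *)

(* Defs.v *)
From mathcomp Require Import all_boot.
From mathcomp Require Import all_classical topology.

Set Implicit Arguments.
Unset Strict Implicit.
Unset Printing Implicit Defensive.

Local Open Scope classical_set_scope.
Local Open Scope card_scope.

(* A cardinal is represented by any set of that cardinality; the lemmas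
   [least_cardP], [card_le_total], [card_minP], [alephSP], [aleph_omegaP],
   [disP] and [DeltaP]
   below justify the representatives chosen here. *)

Definition is_least_card (T : Type) (P : set (set T)) (A : set T) : Prop :=
  P A /\ forall B, P B -> A #<= B.

Definition least_card (T : Type) (P : set (set T)) : set T :=
  xget set0 (is_least_card P).

Definition card_min (T U : Type) (A : set T) (B : set U) : set (T + U) :=
  if A #<= B then inl @` A else inr @` B.

Definition GCH : Prop := forall T U : Type,
  infinite_set [set: T] ->
  [set: T] #<= [set: U] -> [set: U] #<= [set: set T] ->
  [set: U] #= [set: T] \/ [set: U] #= [set: set T].

Lemma least_card_exists (T : Type) (P : set (set T)) :
  P !=set0 -> exists A, is_least_card P A.
Proof.
move=> [A0 PA0].
have [A0e|/set0P[t0 At0]] := eqVneq A0 set0.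
  by exists A0; split=> // B _; rewrite A0e; exact: card_ge0.
pose good (F : set (set T -> T)) :=
  (forall g A, F g -> P A -> A (g A)) /\
  (forall g h A, F g -> F h -> P A -> g A = h A -> g = h).
have [F [[gF1 gF2] Fmax]] : exists F, good F /\
    forall G, F `<` G -> ~ good G.
  apply: Zorn_bigcup => C Cgood Ctot.
  split=> [g A [F CF Fg] PA|g h A [F CF Fg] [G CG Gh] PA e].
    exact: ((Cgood _ CF).1 _ _ Fg PA).
  have [FG|GF] := Ctot _ _ CF CG.
    by apply: ((Cgood _ CG).2 _ _ _ (FG _ Fg) Gh PA e).
  by apply: ((Cgood _ CF).2 _ _ _ Fg (GF _ Gh) PA e).
have [A PA AF] : exists2 A, P A & A `<=` [set g A | g in F].
  apply: contrapT => noA.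
  have pickA (A : set T) : exists x, P A -> A x /\ ~ [set g A | g in F] x.
    have [PA|nPA] := pselect (P A); last by exists t0.
    apply: contrapT => nx; apply: noA; exists A => // x Ax.
    by apply: contrapT => nFx; apply: nx; exists x.
  have [k kP] := choice pickA.
  have Fk : F k.
    apply: contrapT => nFk; apply: (Fmax (F `|` [set k])).
      split=> [g Fg|/(_ k)]; first by left.
      by move=> /(_ (or_intror erefl)).
    split=> [g A [Fg|->] PA|g h A [Fg|->] [Fh|->] PA e //].
    - exact: (gF1 _ _ Fg PA).
    - by have [] := kP A PA.
    - exact: (gF2 _ _ _ Fg Fh PA e).
    - by case: (kP A PA) => _ []; exists g.
    - by case: (kP A PA) => _ []; exists h.
  by case: (kP _ PA0) => _; apply; exists k.
exists A; split=> // B PB.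
have pickF a : exists g : set T -> T, A a -> F g /\ g A = a.
  have [Aa|nAa] := pselect (A a); last by exists (fun=> t0).
  by have [g Fg ga] := AF _ Aa; exists g.
have [f fP] := choice pickF.
have /injfunPex[i] : exists2 i : T -> T, set_fun A B i & set_inj A i.
  exists (fun a => f a B) => [a Aa|a b /set_mem Aa /set_mem Ab e].
    by apply: (gF1 _ _ _ PB); case: (fP _ Aa).
  have [Fa ea] := fP _ Aa; have [Fb eb] := fP _ Ab.
  by rewrite -ea -eb (gF2 _ _ _ Fa Fb PB e).
exact: inj_card_le i.
Qed.

Lemma least_cardP (T : Type) (P : set (set T)) :
  P !=set0 -> is_least_card P (least_card P).
Proof. by move=> /least_card_exists[A PA]; exact: (xgetPex set0 (ex_intro _ A PA)). Qed.

Lemma card_inl (T U : Type) (A : set T) : (@inl T U @` A) #= A.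
Proof. by apply: inj_card_eq => x y _ _ []. Qed.

Lemma card_inr (T U : Type) (A : set U) : (@inr T U @` A) #= A.
Proof. by apply: inj_card_eq => x y _ _ []. Qed.

Lemma card_le_total (T U : Type) (A : set T) (B : set U) :
  A #<= B \/ B #<= A.
Proof.
have [|C [CP Cmin]] := @least_card_exists (T + U)
  [set C | C = inl @` A \/ C = inr @` B]; first by exists (inl @` A); left.
have leA := Cmin _ (or_introl erefl); have leB := Cmin _ (or_intror erefl).
case: CP => CE; rewrite CE in leA leB.
  by left; move: leB; rewrite (card_le_eql (card_inl _ _)) (card_le_eqr (card_inr _ _)).
by right; move: leA; rewrite (card_le_eql (card_inr _ _)) (card_le_eqr (card_inl _ _)).
Qed.

Fixpoint beth (n : nat) : Type := if n is m.+1 then set (beth m) else nat.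

(* The cardinal successor of aleph n is at most beth n.+1, by Cantor's theorem,
   hence it is realized by a subset of [beth n.+1]. *)
Fixpoint aleph (n : nat) : set (beth n) :=
  match n return set (beth n) with
  | 0 => [set: nat]
  | m.+1 => @least_card (set (beth m)) [set A | ~ (A #<= @aleph m)]
  end.
Arguments aleph : clear implicits.

Definition aleph_omega : set {n : nat & beth n} :=
  least_card [set A | forall n, aleph n #<= A].

Lemma card_set_gt (T : Type) (A : set T) : ~ ([set: set T] #<= A).
Proof.
move=> le; have {le} : [set: set T] #<= [set: T].
  by apply: card_le_trans le _; exact: card_leT.
move=> /card_leP[f0].
pose sub (B : set T) : [set: set T] := SigSub (mem_set (I : setT B)).
pose f B : T := set_val (f0 (sub B)).
have finj : injective f.
  by move=> B C /val_inj e; have /(congr1 val) := inj (mem_set I) (mem_set I) e.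
pose D := [set x | exists2 B, f B = x & ~ B x].
have [Df|nDf] := pselect (D (f D)); last by apply: (nDf); exists D.
by have [B /finj BD] := Df; rewrite BD.
Qed.

Lemma alephSP n : ~ (aleph n.+1 #<= aleph n) /\
  forall (U : Type) (B : set U), ~ (B #<= aleph n) -> aleph n.+1 #<= B.
Proof.
have [|nle lemin] := @least_cardP (set (beth n)) [set A | ~ (A #<= aleph n)].
  by exists setT; exact: card_set_gt.
split=> // U B nB.
have [//|/card_subP[C CB Csub]] := card_le_total (aleph n.+1) B.
rewrite -(card_le_eqr CB); apply: lemin => /=.
by rewrite (card_le_eql CB).
Qed.

Lemma aleph_omegaP : (forall n, aleph n #<= aleph_omega) /\
  forall (U : Type) (B : set U), (forall n, aleph n #<= B) -> aleph_omega #<= B.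
Proof.
have [|ub lemin] := @least_cardP {n & beth n} [set A | forall n, aleph n #<= A].
  exists setT => n; apply: card_le_trans (card_leT (existT _ n @` aleph n)).
  have := @inj_card_eq _ _ (aleph n) (existT beth n).
  by rewrite card_eqPle => -[x y _ _ e|//]; exact: (existT_inj2 e).
split=> // U B uB.
have [//|/card_subP[C CB Csub]] := card_le_total aleph_omega B.
rewrite -(card_le_eqr CB); apply: lemin => n /=.
by rewrite (card_le_eqr CB).
Qed.

Lemma card_minP (T U V : Type) (A : set T) (B : set U) (C : set V) :
  card_min A B #<= C <-> A #<= C \/ B #<= C.
Proof.
rewrite /card_min; case: ifPn => AB.
  rewrite (card_le_eql (card_inl _ _)); split; first by left.
  by case=> //; exact: card_le_trans.
rewrite (card_le_eql (card_inr _ _)); split; first by right.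
case=> //; apply: card_le_trans.
by case: (card_le_total A B) => //; rewrite (negPf AB).
Qed.

Section spaces.
Variable X : topologicalType.

Definition homogeneous : Prop := forall x y : X, exists h k : X -> X,
  [/\ continuous h, continuous k, cancel h k, cancel k h & h x = y].

(* The topology on [A] is the one of the subtype [set_type A]. *)
Definition discrete_set (A : set X) : Prop :=
  @nbhs A A = principal_filter.

Definition discrete_cover (C : set (set X)) : Prop :=
  (forall A, C A -> discrete_set A) /\ \bigcup_(A in C) A = [set: X].

Lemma discrete_set1s (x : X) : discrete_set [set x].
Proof.
apply/funext => y; apply/seteqP; split=> B.
  by move=> /nbhs_singleton By _ ->.
move=> By; suff -> : B = setT by exact: filterT.
apply/seteqP; split=> // z _; apply: By => /=; apply: val_inj.
by have /set_mem -> := valP z; have /set_mem -> := valP y.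
Qed.

Definition dis : set (set X) := least_card discrete_cover.

Definition Delta : set X := least_card [set U | open U /\ U !=set0].

Lemma disP : is_least_card discrete_cover dis.
Proof.
apply: least_cardP; exists (range set1); split=> [_ [x _ <-]|].
  exact: discrete_set1s.
by apply/seteqP; split=> // x _; exists [set x] => //; exists x.
Qed.

Lemma DeltaP : [set: X] !=set0 ->
  is_least_card [set U | open U /\ U !=set0] Delta.
Proof.
by move=> X0; apply: least_cardP; exists setT; split=> //; exact: openT.
Qed.

End spaces.
Arguments dis : clear implicits.
Arguments Delta : clear implicits.

(* [inhabited K] excludes the power with exponent 0, which is a point. *)
Definition power_homogeneous (X : topologicalType) : Prop :=
  exists K : Type, inhabited K /\ homogeneous {ptws K -> X}.

(* Main.v *)
Require Import Defs.
From mathcomp Require Import all_boot.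
From mathcomp Require Import all_classical wochoice topology.

(** The argument rests on one transfinite construction and on the following
    notion: for a type [T] of cardinality kappa, a set is a G_kappa set if it is
    an intersection of at most kappa open sets. Suppose that [dis X] is
    neither at least aleph_omega nor countable. Under GCH it is then
    2^kappa = kappa^+ for some infinite kappa, and the goal becomes
    |X| <= 2^kappa, since [Delta X] is at most |X|.

    - Every nonempty closed set [K] has a relative G_kappa point
      ([discrete_cover_Gpoint]). Otherwise well-order the kappa^+ discrete
      pieces so that initial segments have at most kappa elements, and choose
      closed G_delta sets one after the other, each missing the next piece.
      At every stage the part of [K] still available is the trace of a
      G_kappa set, so it has no isolated point and a discrete set cannot
      occupy a relatively open part of it. By compactness some point of [K]
      survives all the choices and lies in no piece.

    - Every point of [X] is a G_kappa point ([homogeneous_Gpoint]). Let [p] be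
      one, and let [h] be a homeomorphism of the power carrying the constant
      function [p] to the constant function [q]; let [f] be a coordinate of
      [h]. Relative G_kappa points in images of cylinders give an increasing
      sequence of sets [A n] of at most kappa coordinates and functions [x n],
      equal to [p] on [A n], such that [f z = f (x n)] as soon as [z] agrees
      with [x n] on [A n.+1]. If [y] equals [p] on the union [Aw] of the [A n],
      then the function equal to [x n] on [Aw] and to [y] elsewhere has the
      same value as [x n] under [f], and agrees with [y] on any given finite
      set of coordinates for large [n]; so [f (x n)] converges to [f y]. Limits
      being unique, [f] is constantly [q] on a G_kappa cylinder containing the
      constant function [p]; moved by [h] and restricted to a slice, this
      cylinder exhibits [q] as a G_kappa point.

    - A compactum all of whose points are G_kappa has at most 2^kappa points
      (Arhangel'skii's theorem, [card_le_compact_Gpoints]).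

    A countable [dis X] is excluded by a Baire category argument unless [X]
    has an isolated point, in which case [Delta X] is at most one
    ([countable_discrete_cover]). *)

Set Implicit Arguments.
Unset Strict Implicit.
Unset Printing Implicit Defensive.

Local Open Scope classical_set_scope.
Local Open Scope card_scope.

(** * Cardinal arithmetic *)

Lemma card_le_inj (A B : Type) (f : A -> B) :
  injective f -> [set: A] #<= [set: B].
Proof.
move=> finj; suff /injfunPex[g] : exists2 g : A -> B,
  set_fun [set: A] [set: B] g & set_inj [set: A] g by exact: inj_card_le.
by exists f => // x y _ _ /finj.
Qed.

Lemma card_leT_injP (A : Type) (B : pointedType) :
  [set: A] #<= [set: B] <-> exists f : A -> B, injective f.
Proof.
split=> [/pcard_injP[f finj]|[f]]; last exact: card_le_inj.
by exists f => x y; apply: finj; rewrite inE.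
Qed.

Lemma card_le_set (A : Type) (B : pointedType) :
  [set: A] #<= [set: B] -> [set: set A] #<= [set: set B].
Proof.
move=> /card_leT_injP[f finj]; apply: (@card_le_inj _ _ (fun C => f @` C)) => C D e.
apply/seteqP; split=> x Cx.
  by have : (f @` D) (f x); [rewrite -e; exists x|move=> [y ? /finj <-]].
by have : (f @` C) (f x); [rewrite e; exists x|move=> [y ? /finj <-]].
Qed.

(** Every type obtained from [T] by the finitary constructions below stays below
    [T], and function types stay below its power set. *)
Section SquareAbsorbing.
Variable T : pointedType.
Hypothesis natT : [set: nat] #<= [set: T].
Hypothesis TT : [set: T * T] #<= [set: T].

Lemma card_le_prod (A B : Type) :
  [set: A] #<= [set: T] -> [set: B] #<= [set: T] -> [set: A * B] #<= [set: T].
Proof.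
move: TT => /card_leT_injP[p pinj] /card_leT_injP[f finj] /card_leT_injP[g ginj].
apply: (@card_le_inj _ _ (fun ab => p (f ab.1, g ab.2))) => -[a b] [c d] /=.
by move=> /pinj[/finj -> /ginj ->].
Qed.

Lemma card_le_seq (A : Type) : [set: A] #<= [set: T] -> [set: seq A] #<= [set: T].
Proof.
move: TT natT => /card_leT_injP[p pinj] /card_leT_injP[n ninj] /card_leT_injP[f finj].
pose code := fix code (s : seq A) : T :=
  if s is a :: s' then p (n 1, p (f a, code s')) else p (n 0, n 0).
apply: (@card_le_inj _ _ code); elim=> [|a s IHs] [|b r] //=.
- by move=> /pinj[/ninj].
- by move=> /pinj[/ninj].
- by move=> /pinj[/pinj[/finj -> /IHs ->]].
Qed.

Lemma card_le_option (A : Type) :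
  [set: A] #<= [set: T] -> [set: option A] #<= [set: T].
Proof.
move=> /card_le_seq; apply: card_le_trans.
by apply: (@card_le_inj _ _ (oapp (cons^~ [::]) [::])) => -[a|] [b|] //= [->].
Qed.

Lemma card_le_fun (A B : Type) :
  [set: A] #<= [set: T] -> [set: B] #<= [set: T] ->
  [set: A -> B] #<= [set: set T].
Proof.
move=> AT BT; apply: (card_le_trans _ (card_le_set (card_le_prod AT BT))).
pose graph (f : A -> B) := [set ab | f ab.1 = ab.2].
apply: (@card_le_inj _ _ graph) => f g e; apply/funext => a.
by have : graph f (a, f a) by []; rewrite e.
Qed.

Lemma card_le_bigcup (I U : Type) (J : set I) (F : I -> set U) :
  J #<= [set: T] -> (forall i, J i -> F i #<= [set: T]) ->
  \bigcup_(i in J) F i #<= [set: T].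
Proof.
move: TT => /card_leT_injP[p pinj] /pcard_injP[j jinj] FT.
have /choice[f fP] i : exists f : U -> T, J i -> {in F i &, injective f}.
  have [/FT/pcard_injP[f fi]|nJ] := pselect (J i); first by exists f.
  by exists (fun=> point).
have /choice[c cP] u : exists c : T, (\bigcup_(i in J) F i) u ->
    exists i, [/\ J i, F i u & c = p (j i, f i u)].
  have [[i Ji Fiu]|nu] := pselect ((\bigcup_(i in J) F i) u); last by exists point.
  by exists (p (j i, f i u)) => _; exists i.
apply/pcard_injP; exists c => u v /set_mem/cP[i [Ji Fiu ->]].
move=> /set_mem/cP[i' [Ji' Fiv ->]] /pinj[/jinj].
rewrite !inE => /(_ Ji Ji') eii; rewrite -{}eii in Fiv *.
by apply: fP; rewrite ?inE.
Qed.

(** Two subsets of [T] are coded by one subset of [T * bool]. *)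
Lemma card_set_square : [set: set T * set T] #<= [set: set T].
Proof.
have boolT : [set: bool] #<= [set: T].
  by apply: (card_le_trans _ natT); apply: (@card_le_inj _ _ nat_of_bool) => -[] [].
have TbT := card_le_prod (card_lexx [set: T]) boolT.
apply: (card_le_trans _ (card_le_set TbT)).
pose code (CD : set T * set T) :=
  [set tb : T * bool | if tb.2 then CD.1 tb.1 else CD.2 tb.1].
apply: (@card_le_inj _ _ code) => -[C D] [C' D'] e; congr (_, _).
  by apply/funext => t; have := congr1 (@^~ (t, true)) e.
by apply/funext => t; have := congr1 (@^~ (t, false)) e.
Qed.

End SquareAbsorbing.

(** * Alephs and well-orders under GCH *)

Lemma card_nat_beth k : [set: nat] #<= [set: beth k].
Proof.
elim: k => [|k IHk]; first exact: card_lexx.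
apply: (card_le_trans IHk); apply: (@card_le_inj _ _ set1) => x y.
by move/seteqP => -[/(_ x erefl)].
Qed.

Lemma beth_pointed k : exists T : pointedType, T = beth k :> Type.
Proof. by case: k => [|k]; [exists nat|exists (set (beth k))]. Qed.

(** Squares are absorbed along the beth hierarchy by a plain induction, which
    under GCH covers all the alephs of finite index. *)
Lemma card_beth_square k : [set: beth k * beth k] #<= [set: beth k].
Proof.
elim: k => [|k IHk]; first exact: (countableP [set: nat * nat]).
have natk := card_nat_beth k.
rewrite /=; case: (beth_pointed k) => T e; rewrite -e in IHk natk *.
exact: card_set_square.
Qed.

Lemma not_card_le_total (T U : Type) (A : set T) (B : set U) :
  ~ (A #<= B) -> B #<= A.
Proof. by case: (card_le_total A B). Qed.

Lemma GCH_aleph k : GCH -> aleph k #= [set: beth k].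
Proof.
move=> gch; elim: k => [|k IHk]; first exact: card_eqxx.
have [nle lemin] := alephSP k; rewrite (card_le_eqr IHk) in nle.
have lepow : aleph k.+1 #<= [set: set (beth k)].
  by apply: lemin; rewrite (card_le_eqr IHk); exact: card_set_gt.
have lelow : [set: beth k] #<= aleph k.+1 by exact: not_card_le_total.
have eqT := card_setT (aleph k.+1).
have := gch (beth k) (aleph k.+1).
rewrite (card_le_eqr eqT) (card_le_eql eqT) !(card_eql eqT).
case=> //; first by apply/infiniteP; exact: card_nat_beth.
by rewrite card_eq_le => /andP[/nle].
Qed.

Lemma GCH_beth_succ k (U : Type) (B : set U) : GCH ->
  ~ (B #<= [set: beth k]) -> [set: beth k.+1] #<= B.
Proof.
move=> gch; rewrite -(card_le_eqr (GCH_aleph k gch)) => /(alephSP k).2.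
by rewrite (card_le_eql (GCH_aleph k.+1 gch)).
Qed.

Lemma GCH_lt_aleph_omega (U : Type) (B : set U) : GCH ->
  ~ (aleph_omega #<= B) ->
  B #<= [set: nat] \/ exists k, B #= [set: beth k.+1].
Proof.
move=> gch nB; have [n] : exists n, ~ (aleph n #<= B).
  by apply: contrapT => nn; apply/nB/aleph_omegaP.2 => n;
    apply: contrapT => nle; apply: nn; exists n.
elim: n => [|n IHn] nle; first by left; exact: not_card_le_total.
have [leB|/IHn//] := pselect (aleph n #<= B).
have geB : B #<= aleph n by apply: contrapT => /(alephSP n).2.
case: n {IHn nle} => [|k] in leB geB; first by left.
right; exists k; rewrite -(card_eqr (GCH_aleph k.+1 gch)) card_eqPle.
by split.
Qed.

Lemma well_founded_order (E : Type) : exists lt : E -> E -> Prop,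
  [/\ well_founded lt, (forall i j l, lt i j -> lt j l -> lt i l)
    & (forall i j, [\/ lt i j, i = j | lt j i])].
Proof.
have [R Rwo] := @well_ordering_principle {classic E}.
have wo : wo_chain R predT by exact: withinW.
have Rtot x y : R x y || R y x by exact: (wo_chainW wo).
have Ranti x y : R x y -> R y x -> x = y.
  by move=> xy yx; apply: (wo_chain_antisymmetric wo) => //; rewrite xy.
have Rmin (P : set E) : P !=set0 -> exists2 z, P z & forall y, P y -> R z y.
  move=> [x Px]; have [|z [[Pz lez] _]] := Rwo (fun y => `[<P y>]).
    by exists x; exact/asboolP.
  by exists z => [|y Py]; [exact/asboolP | apply: lez; exact/asboolP].
have Rtrans x y z : R x y -> R y z -> R x z.
  move=> xy yz; have [|m mP lem] := Rmin [set u | [\/ u = x, u = y | u = z]].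
    by exists x; exact: Or31.
  have xm := lem x (Or31 _ _ erefl); have ym := lem y (Or32 _ _ erefl).
  have zm := lem z (Or33 _ _ erefl).
  case: mP => me; rewrite me in xm ym zm => //.
    by rewrite (Ranti x y).
  by rewrite -(Ranti y z).
exists (fun x y => R x y /\ x <> y); split.
- move=> x; apply: contrapT => nx.
  have [|z nz zmin] := Rmin [set y | ~ Acc (fun x y => R x y /\ x <> y) y].
    by exists x.
  apply: nz; split=> y [yz /= neq]; apply: contrapT => /zmin zy.
  exact/neq/Ranti.
- move=> x y z [xy nxy] [yz nyz]; split; first exact: Rtrans yz.
  by move=> xz; rewrite -{}xz in yz nyz; apply/nxy/Ranti.
- move=> x y; have [xy|nxy] := pselect (x = y); first exact: Or32.
  by have /orP[xy|yx] := Rtot x y; [apply: Or31|apply: Or33; split=> // /esym].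
Qed.

Lemma wf_least (I : Type) (lt : I -> I -> Prop) (P : set I) : well_founded lt ->
  P !=set0 -> exists2 i, P i & forall j, lt j i -> ~ P j.
Proof.
move=> wf [i Pi]; apply: contrapT => nmin.
elim/(well_founded_ind wf): i Pi => i IH Pi.
by apply: nmin; exists i => // j /IH.
Qed.

(** An initial ordinal of size [beth k.+1]: if some segment of a well-order is
    larger than [beth k], the first such segment already has the full size. *)
Lemma small_segments_wellorder k : GCH ->
  exists (I : Type) (lt : I -> I -> Prop),
  [/\ well_founded lt, (forall i j l, lt i j -> lt j l -> lt i l),
      (forall i j, [\/ lt i j, i = j | lt j i]),
      (forall i, [set j | lt j i] #<= [set: beth k])
    & [set: beth k.+1] #<= [set: I]].
Proof.
move=> gch; have [lt [wf ltT lttot]] := well_founded_order (beth k.+1).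
have [small|] := pselect (forall i, [set j | lt j i] #<= [set: beth k]).
  by exists (beth k.+1), lt; split=> //; exact: card_lexx.
move=> /existsNP/(wf_least wf)[m mlarge mleast].
exists [set j | lt j m], (fun i j => lt (val i) (val j)).
have valm (i : [set j | lt j m]) : lt (val i) m by have /set_mem := valP i.
split.
- move=> i; have [x xi] : exists x, x = val i by exists (val i).
  elim/(well_founded_ind wf): x i xi => x IH i xi.
  by split=> j ji; apply: (IH (val j)) => //; rewrite xi.
- by move=> i j l; exact: ltT.
- move=> i j; case: (lttot (val i) (val j)) => [ij|/val_inj ij|ji].
  + exact: Or31.
  + exact: Or32.
  + exact: Or33.
- move=> i; have /mleast/contrapT := valm i; apply: card_le_trans.
  rewrite -(card_le_eql (@inj_card_eq _ _ _ val _)) => [|? ? _ _ /val_inj//].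
  by apply: subset_card_le => _ [j ji <-].
- have := GCH_beth_succ gch mlarge.
  by rewrite -(card_le_eqr (card_setT _)).
Qed.

(** * Compact Hausdorff spaces *)

Section Compactness.
Variable X : topologicalType.

Lemma compact_finite_cover (I : eqType) (H : set X) (P : set I) (U : I -> set X) :
  compact H -> (forall i, P i -> open (U i)) -> H `<=` \bigcup_(i in P) U i ->
  exists2 s : seq I, (forall i, i \in s -> P i) &
    forall x, H x -> exists2 i, i \in s & U i x.
Proof.
move=> cH oU HU; apply: contrapT => nofin.
pose D := [set s : seq I | forall i, i \in s -> P i].
pose B (s : seq I) := H `&` [set x | forall i, i \in s -> ~ U i x].
have FF : Filter (filter_from D B).
  apply: filter_from_filter; first by exists [::].
  move=> s t Ds Dt; exists (s ++ t).
    by move=> i; rewrite mem_cat => /orP[/Ds|/Dt].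
  move=> x [Hx nx]; split; split=> // i ist; apply: nx; rewrite mem_cat ist //.
  by rewrite orbT.
have PF : ProperFilter (filter_from D B).
  apply: filter_from_proper => s Ds; apply: contrapT => Bs0.
  apply: nofin; exists s => // x Hx; apply: contrapT => nx.
  by apply: Bs0; exists x; split=> // i si Ux; apply: nx; exists i.
have [|x [Hx clx]] := cH _ PF; first by exists [::] => // y [].
have [i Pi Uix] := HU x Hx.
have [||y [[_ /(_ i)]]] := clx (B [:: i]) (U i).
- by exists [:: i] => // j; rewrite inE => /eqP ->.
- by apply: open_nbhs_nbhs; split=> //; exact: oU.
- by rewrite inE eqxx => /(_ isT).
Qed.

(** A finite subfamily of a chain-indexed family has a largest index, so the
    finite intersection property only has to be checked on initial segments. *)
Lemma compact_chain (I : Type) (lt : I -> I -> Prop) (K : set X) (P : set I)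
    (V : I -> set X) :
  (forall i j l, lt i j -> lt j l -> lt i l) ->
  (forall i j, [\/ lt i j, i = j | lt j i]) ->
  compact K -> K !=set0 -> (forall i, P i -> closed (V i)) ->
  (forall i, P i ->
     exists2 x, K x & V i x /\ forall j, P j -> lt j i -> V j x) ->
  exists2 x, K x & forall i, P i -> V i x.
Proof.
move=> ltT lttot cK [x0 Kx0] cV ex; apply: contrapT => nx.
have [i Pi||s sP scov] :=
  @compact_finite_cover {classic I} K P (fun i => ~` V i) cK.
- exact/closed_openC/cV.
- move=> x Kx; apply: contrapT => nc; apply: nx; exists x => // i Pi.
  by apply: contrapT => nV; apply: nc; exists i.
have [m sm mmax] : exists2 m, m \in s & forall i, i \in s -> lt i m \/ i = m.
  have : s != [::] by case: (scov x0 Kx0) => i; case: (s).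
  elim: (s) => // i [|j t] IHt _.
    by exists i => [|l]; rewrite inE // => /eqP ->; right.
  have [//|m mt mmax] := IHt.
  have [im|->|mi] := lttot i m.
  - exists m => [|l]; first by rewrite inE mt orbT.
    by rewrite inE => /orP[/eqP->|/mmax//]; left.
  - exists m => [|l]; first by rewrite inE mt orbT.
    by rewrite inE => /orP[/eqP->|/mmax//]; right.
  - exists i => [|l]; first by rewrite inE eqxx.
    rewrite inE => /orP[/eqP->|/mmax[lm|->]]; [by right|left|by left].
    exact: ltT mi.
have [x Kx [Vm Vlt]] := ex m (sP m sm).
have [i si] := scov x Kx; apply.
by have [im|->//] := mmax i si; apply: Vlt => //; exact: sP.
Qed.

Hypothesis hX : hausdorff_space X.
Hypothesis cX : compact [set: X].

Lemma shrink_open (U : set X) x : open U -> U x ->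
  exists O, [/\ open O, O x & closure O `<=` U].
Proof.
move=> oU Ux; have Unbhs : nbhs x U by exact: open_nbhs_nbhs.
have [W Wx clW] := compact_regular hX cX (@filterT _ (nbhs x) _) Unbhs.
exists W^°; split; [exact: open_interior|exact: Wx|].
by apply: subset_trans clW; apply: closureS; exact: interior_subset.
Qed.

Lemma open_setD1 (U : set X) x : open U -> open (U `\ x).
Proof.
move=> oU; apply: openI => //; apply: closed_openC.
exact/accessible_closed_set1/hausdorff_accessible.
Qed.

Lemma separating_open (x y : X) : x <> y ->
  exists U V, [/\ open U, open V, U x, V y & U `&` V = set0].
Proof.
move: hX; rewrite open_hausdorff => sep /eqP/sep[[U V] /= [/set_mem Ux /set_mem Vy]].
by move=> [oU oV /eqP UV]; exists U, V.
Qed.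

Lemma discrete_set_isolate (D : set X) x : discrete_set D -> D x ->
  exists U, [/\ open U, U x & U `&` D `<=` [set x]].
Proof.
move=> dD Dx; pose x' : D := SigSub (mem_set Dx).
have : @nbhs D D x' [set x'] by rewrite dD.
rewrite nbhsE => -[W [[U oU <-] Ux] UW]; exists U; split=> // y [Uy Dy].
have /UW e : (set_val @^-1` U) (SigSub (mem_set Dy) : D) by [].
exact: (congr1 val e).
Qed.

End Compactness.

(** * Sets of type G_kappa *)

(** A G_kappa set, for kappa the cardinality of [T]. *)
Definition Gset (T : Type) (X : topologicalType) (S : set X) : Prop :=
  exists F : set (set X), [/\ F #<= [set: T], (forall U, F U -> open U)
    & S = \bigcap_(U in F) U].

Section Gsets.
Variable T : pointedType.
Hypothesis natT : [set: nat] #<= [set: T].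
Hypothesis TT : [set: T * T] #<= [set: T].

Lemma card_set1_leT (U : Type) (x : U) : [set x] #<= [set: T].
Proof. by apply/pcard_injP; exists (fun=> point) => y z; rewrite !inE => -> ->. Qed.

Section OneSpace.
Variable X : topologicalType.
Implicit Types S U : set X.

Lemma Gset_open U : open U -> Gset T U.
Proof.
move=> oU; exists [set U]; split=> [|V ->//|]; first exact: card_set1_leT.
by rewrite bigcap_set1.
Qed.

Lemma Gset_bigcap (I : Type) (J : set I) (S : I -> set X) :
  J #<= [set: T] -> (forall i, J i -> Gset T (S i)) ->
  Gset T (\bigcap_(i in J) S i).
Proof.
move=> JT GS; have /choice[F FP] i : exists F : set (set X), J i ->
    [/\ F #<= [set: T], (forall U, F U -> open U) & S i = \bigcap_(U in F) U].
  by have [/GS[F FP]|nJ] := pselect (J i); [exists F|exists set0].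
exists (\bigcup_(i in J) F i); split.
- by apply: card_le_bigcup => // i /FP[].
- by move=> U [i /FP[_ oF _]]; exact: oF.
- apply/seteqP; split=> [x Sx U [i Ji FU]|x Fx i Ji].
    by have := Sx i Ji; have [_ _ ->] := FP i Ji; exact.
  by have [_ _ ->] := FP i Ji => U FU; apply: Fx; exists i.
Qed.

Lemma Gset_setI (S S' : set X) : Gset T S -> Gset T S' -> Gset T (S `&` S').
Proof.
move=> GS GS'; rewrite -bigcap2E; apply: Gset_bigcap.
  by apply: card_le_trans natT; exact: card_leT.
by move=> [|[|n]] _ //=; exact/Gset_open/openT.
Qed.

Lemma Gset_preimage (Y : topologicalType) (f : X -> Y) (S : set Y) :
  continuous f -> Gset T S -> Gset T (f @^-1` S).
Proof.
move=> /continuousP cf [F [FT oF ->]].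
exists [set f @^-1` U | U in F]; split.
- exact: card_le_trans (card_image_le _ _) FT.
- by move=> _ [U FU <-]; exact/cf/oF.
- by rewrite preimage_bigcap bigcap_image.
Qed.

Hypothesis hX : hausdorff_space X.
Hypothesis cX : compact [set: X].

(** The set is the intersection of a sequence of open sets in which each
    contains the closure of the next. *)
Lemma closed_Gset_in_open U x : open U -> U x ->
  exists V, [/\ closed V, Gset T V, V x & V `<=` U].
Proof.
move=> oU Ux.
have /choice[s sP] (W : set X) : exists O : set X, open W -> W x ->
    [/\ open O, O x & closure O `<=` W].
  have [[oW Wx]|nW] := pselect (open W /\ W x).
    by have [O OP] := shrink_open hX cX oW Wx; exists O.
  by exists set0 => oW Wx; case: nW.
pose O n := iter n s U.
have OP n : open (O n) /\ O n x.
  by elim: n => //= n [oO Ox]; have [] := sP _ oO Ox.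
have clO n : closure (O n.+1) `<=` O n by have [oO Ox] := OP n; have [] := sP _ oO Ox.
exists (\bigcap_n O n); split.
- rewrite [X in closed X](_ : _ = \bigcap_n closure (O n)).
    by apply: closed_bigI => n _; exact: closed_closure.
  apply/seteqP; split=> y Oy n _; first exact/subset_closure/Oy.
  exact/clO/Oy.
- by apply: Gset_bigcap => // n _; apply: Gset_open; case: (OP n).
- by move=> n _; case: (OP n).
- by move=> y /(_ 0 I).
Qed.

(** * Coverings by discrete sets *)

(** One step of the transfinite construction: an open neighbourhood of a point
    of [D] which contains no other point of [D] meets [K `&` G] in a further
    point, since otherwise the point of [D] would be a G_kappa point of [K]. *)
Lemma avoid_discrete (K G D : set X) :
  (forall G' x, Gset T G' -> K `&` G' <> [set x]) ->
  Gset T G -> K `&` G !=set0 -> discrete_set D ->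
  exists V, [/\ closed V, Gset T V, K `&` G `&` V !=set0
              & K `&` G `&` V `&` D = set0].
Proof.
move=> noiso GG [z KGz] dD.
have [[x [[Kx Gx] Dx]]|nD] := pselect (K `&` G `&` D !=set0); last first.
  exists setT; split; [exact: closedT|exact/Gset_open/openT| |].
    by rewrite setIT; exists z.
  by rewrite setIT; apply: contrapT => /eqP/set0P/nD.
have [U [oU Ux UD]] := discrete_set_isolate dD Dx.
have [y [[Ky [Gy Uy]] yx]] : exists y, (K `&` (G `&` U)) y /\ y <> x.
  apply: contrapT => ny; apply: (noiso (G `&` U) x).
    exact/Gset_setI/Gset_open.
  apply/seteqP; split=> [y Ky|_ ->] //.
  by apply: contrapT => yx; apply: ny; exists y.
have [V [cV GV Vy VU]] : exists V, [/\ closed V, Gset T V, V y & V `<=` U `\ x].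
  by apply: closed_Gset_in_open; [exact: open_setD1|split].
exists V; split=> //; first by exists y.
rewrite -subset0 => w [[_ /VU[Uw wx]] Dw]; apply: wx.
exact: UD.
Qed.

(** Transfinite iteration of [avoid_discrete]. The stage [G i], an intersection
    of fewer than kappa^+ of the chosen sets, is still a G_kappa set. *)
Lemma discrete_cover_Gpoint (I : Type) (lt : I -> I -> Prop) (D : I -> set X)
    (K : set X) :
  well_founded lt -> (forall i j l, lt i j -> lt j l -> lt i l) ->
  (forall i j, [\/ lt i j, i = j | lt j i]) ->
  (forall i, [set j | lt j i] #<= [set: T]) ->
  (forall i, discrete_set (D i)) -> \bigcup_i D i = [set: X] ->
  closed K -> K !=set0 ->
  exists x G, Gset T G /\ K `&` G = [set x].
Proof.
move=> wf ltT lttot small dD covD clK K0; apply: contrapT => nx.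
have cK : compact K by exact: subclosed_compact cX _.
have noiso G x : Gset T G -> K `&` G <> [set x].
  by move=> GG e; apply: nx; exists x, G.
(* Choosing [V] globally, as a function of the stage and of the discrete set,
   makes the recursion below non-dependent. *)
have /choice[c cP] (GD : set X * set X) : exists V, [/\ closed V, Gset T V
  & Gset T GD.1 -> K `&` GD.1 !=set0 -> discrete_set GD.2 ->
    K `&` GD.1 `&` V !=set0 /\ K `&` GD.1 `&` V `&` GD.2 = set0].
  have [[GG [KG0 dD2]]|nG] := pselect (Gset T GD.1 /\ K `&` GD.1 !=set0 /\
      discrete_set GD.2).
    by have [V [? ? ? ?]] := avoid_discrete noiso GG KG0 dD2; exists V; split.
  exists setT; split; [exact: closedT|exact/Gset_open/openT|].
  by move=> ? ? ?; case: nG.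
pose step i (V : forall j, lt j i -> set X) :=
  c ([set x | forall j (ji : lt j i), V j ji x], D i).
pose V := Fix wf (fun=> set X) step.
pose G i := \bigcap_(j in [set j | lt j i]) V j.
have VE i : V i = c (G i, D i).
  rewrite {1}/V Fix_eq // => {}i f g fg; rewrite /step.
  by congr (c (_, _)); apply/seteqP; split=> x h j ji;
    [rewrite -fg|rewrite fg]; exact: h.
have cV i : closed (V i) by rewrite VE; case: (cP (G i, D i)).
have GV i : Gset T (V i) by rewrite VE; case: (cP (G i, D i)).
have GG i : Gset T (G i) by exact: Gset_bigcap.
have VP i : K `&` G i !=set0 ->
    K `&` G i `&` V i !=set0 /\ K `&` G i `&` V i `&` D i = set0.
  by move=> KG; rewrite VE; case: (cP (G i, D i)) => _ _ /(_ (GG i) KG (dD i)).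
have KG i : K `&` G i !=set0.
  elim/(well_founded_ind wf): i => i IH.
  have [//|j /IH/VP[[x [[Kx Gx] Vx]] _]|x Kx xV] :=
    compact_chain ltT lttot cK K0 (P := [set j | lt j i]) (V := V).
    by exists x => //; split=> // l _ lj; exact: Gx.
  by exists x.
have [//|j _|x Kx xV] := compact_chain ltT lttot cK K0 (P := setT) (V := V).
  have [[x [[Kx Gx] Vx]] _] := VP j (KG j).
  by exists x => //; split=> // l _ lj; exact: Gx.
have [i _ Dix] : (\bigcup_i D i) x by rewrite covD.
have [_ /seteqP[/(_ x)]] := VP i (KG i).
by move=> + _; apply; split=> //; split; [split=> // j _|]; exact: xV.
Qed.

End OneSpace.
End Gsets.

(** The countable analogue of [discrete_cover_Gpoint], in which finite stages
    are kept nonempty by working with open sets. *)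
Lemma countable_discrete_cover (X : topologicalType) (D : nat -> set X) :
  hausdorff_space X -> compact [set: X] -> [set: X] !=set0 ->
  (forall n, discrete_set (D n)) -> \bigcup_n D n = [set: X] ->
  exists x : X, open [set x].
Proof.
move=> hX cX X0 dD covD; apply: contrapT => niso.
have /choice[c cP] (UD : set X * set X) : exists O : set X, [/\ open O
  & open UD.1 -> UD.1 !=set0 -> discrete_set UD.2 ->
    [/\ O !=set0, closure O `<=` UD.1 & closure O `&` UD.2 = set0]].
  case: UD => U D' /=.
  have [[oU [[x0 Ux0] dD']]|nG] := pselect (open U /\ U !=set0 /\ discrete_set D');
    last by exists set0; split; [exact: open0|move=> ? ? ?; case: nG].
  have [W [oW WU [y Wy] WD]] : exists W, [/\ open W, W `<=` U, W !=set0 & W `&` D' = set0].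
    have [[x [Ux Dx]]|nD] := pselect (U `&` D' !=set0); last first.
      by exists U; split=> //; [exists x0 | apply: contrapT => /eqP/set0P/nD].
    have [N [oN Nx ND]] := discrete_set_isolate dD' Dx.
    exists ((U `&` N) `\ x); split.
    - by apply: open_setD1 => //; exact: openI.
    - by move=> y [[]].
    - apply: contrapT => n0; apply: niso; exists x.
      rewrite (_ : [set x] = U `&` N); first exact: openI.
      apply/seteqP; split=> [_ -> //|y UNy].
      by apply: contrapT => yx; apply: n0; exists y.
    - by rewrite -subset0 => y [[[Uy Ny] yx] Dy]; apply: yx; exact: ND.
  have [O [oO Oy clO]] := shrink_open hX cX oW Wy.
  exists O; split=> // _ _ _; split; [by exists y|exact: subset_trans WU|].
  by rewrite -subset0 -WD; exact: setSI.
pose U := fix U n : set X := if n is m.+1 then c (U m, D m) else setT.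
have UP n : open (U n) /\ U n !=set0.
  elim: n => [|n [oU U0]] /=; first by split=> //; exact: openT.
  by case: (cP (U n, D n)) => oO /(_ oU U0 (dD n))[].
have US n : closure (U n.+1) `<=` U n /\ closure (U n.+1) `&` D n = set0.
  by case: (UP n) => oU U0; case: (cP (U n, D n)) => oO /(_ oU U0 (dD n))[].
have Umono m n : m <= n -> U n `<=` U m.
  elim: n => [|n IHn]; first by rewrite leqn0 => /eqP ->.
  rewrite leq_eqVlt => /orP[/eqP ->//|]; rewrite ltnS => /IHn.
  by apply: subset_trans; apply: subset_trans (US n).1; exact: subset_closure.
have ltT (i j l : nat) : i < j -> j < l -> i < l by exact: ltn_trans.
have lttot (i j : nat) : [\/ i < j, i = j | j < i].
  by case: (ltngtP i j) => ij; [exact: Or31|exact: Or33|exact: Or32].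
have [n _|n _|x _ xU] := compact_chain ltT lttot cX X0 (P := setT)
    (V := fun n => closure (U n.+1)).
- exact: closed_closure.
- have [x Ux] := (UP n.+1).2; exists x => //; split; first exact: subset_closure.
  by move=> j _ jn; apply: subset_closure; apply: Umono Ux; exact: ltnW.
have [n _ Dx] : (\bigcup_n D n) x by rewrite covD.
have [_ /seteqP[/(_ x) + _]] := US n; apply; split=> //.
exact: xU.
Qed.

(** * Powers and homogeneity *)

Lemma ptws_proj_continuous (J : Type) (X : topologicalType) (j : J) :
  continuous (fun z : {ptws J -> X} => z j).
Proof. exact: (@proj_continuous {classic J} (fun=> X) j). Qed.

(** The sets of functions agreeing with [x] on a finite set form a filter base
    converging to [x]; this is coarser information than a basic box, but all
    that the modification of functions at infinitely many coordinates needs. *)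
Lemma ptws_nbhs_support (J : Type) (X : topologicalType) (x : {ptws J -> X})
    (U : set {ptws J -> X}) : nbhs x U ->
  exists2 s : set J, finite_set s &
    forall z : {ptws J -> X}, (forall j, s j -> z j = x j) -> U z.
Proof.
pose B (s : set J) := [set z : {ptws J -> X} | forall j, s j -> z j = x j].
have FF : Filter (filter_from finite_set B).
  apply: filter_from_filter; first by exists set0; exact: finite_set0.
  move=> s t fs ft; exists (s `|` t); first by rewrite finite_setU.
  by move=> z zst; split=> j ?; apply: zst; [left|right].
suff : filter_from finite_set B --> x by move=> /[apply] -[s fs sU]; exists s.
apply/cvg_sup => j A [_ [[W oW <-] Wx WA]].
exists [set j]; first exact: finite_set1.
by move=> z zj; apply: WA; rewrite /= zj.
Qed.

Section PowerHomogeneous.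
Variables (T : pointedType) (X : topologicalType) (J : Type).
Hypothesis natT : [set: nat] #<= [set: T].
Hypothesis TT : [set: T * T] #<= [set: T].
Hypothesis hX : hausdorff_space X.
Hypothesis cX : compact [set: X].
Hypothesis GpointX : forall K : set X, closed K -> K !=set0 ->
  exists x G, Gset T G /\ K `&` G = [set x].

Let cylinder (p : X) (A : set J) : set {ptws J -> X} :=
  [set z | forall j, A j -> z j = p].

Lemma closed_image_cylinder (f : {ptws J -> X} -> X) p (A : set J) :
  continuous f -> closed (f @` cylinder p A).
Proof.
move=> cf; apply: compact_closed => //; apply: continuous_compact.
  exact: continuous_subspaceT.
rewrite (_ : cylinder p A =
  [set z : {ptws J -> X} | forall j, (if `[< A j >] then [set p] else setT) (z j)]).
  have cA (j : J) : compact (if `[< A j >] then [set p] else [set: X]).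
    by case: ifP => _; [exact: compact_set1|].
  exact: (@tychonoff {classic J} (fun=> X) _ cA).
apply/seteqP; split=> z zA j; first by case: asboolP => // /zA.
by move=> Aj; have := zA j; rewrite asboolT.
Qed.

Lemma Gset_cylinder p (A : set J) :
  A #<= [set: T] -> Gset T [set p] -> Gset T (cylinder p A).
Proof.
move=> AT Gp; rewrite (_ : cylinder p A =
    \bigcap_(j in A) ((fun z : {ptws J -> X} => z j) @^-1` [set p])) //.
apply: Gset_bigcap => // j _; apply: Gset_preimage => //.
exact: ptws_proj_continuous.
Qed.

(** Take [f x] to be a relative G_kappa point of the image of the cylinder over
    [A], and add to [A] finitely many coordinates for each of the open sets that
    isolate it: agreement with [x] on the result forces the same value. *)
Lemma cylinder_refine (f : {ptws J -> X} -> X) p (A : set J) :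
  continuous f -> A #<= [set: T] ->
  exists x A', [/\ cylinder p A x, A `<=` A', A' #<= [set: T]
    & forall z, (forall j, A' j -> z j = x j) -> f z = f x].
Proof.
move=> cf AT.
have [|y [_ [[F [FT oF ->]] /seteqP[fAy yfA]]]] := GpointX (closed_image_cylinder (p := p) (A := A) cf).
  by exists (f (fun=> p)), (fun=> p).
have [[x Ax fx] Fy] := yfA y erefl.
have /choice[s sP] (U : set X) : exists s : set J, F U -> finite_set s /\
    forall z : {ptws J -> X}, (forall j, s j -> z j = x j) -> U (f z).
  have [FU|nFU] := pselect (F U); last by exists set0.
  have [|s fs sU] := @ptws_nbhs_support J X x (f @^-1` U).
    by apply/cf/open_nbhs_nbhs; split; [exact: oF|rewrite fx; exact: Fy].
  by exists s.
exists x, (A `|` \bigcup_(U in F) s U); split=> //.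
- rewrite -bigcup2E; apply: (card_le_bigcup TT).
    by apply: card_le_trans natT; exact: card_leT.
  move=> [|[|n]] _ //=.
  apply: (card_le_bigcup TT) => // U /sP[+ _].
  by move=> /finite_set_countable /card_le_trans; exact.
- move=> z zx; rewrite fx; apply: fAy; split.
    by exists z => // j Aj; rewrite zx ?Ax//; left.
  by move=> U FU; have [_] := sP U FU; apply=> j sj; apply: zx; right; exists U.
Qed.

(** The constant function [p] need not be a G_kappa point of the power, so the
    property is carried by cylinders over kappa many coordinates: the image under [h] of such a
    cylinder at [p] is a G_kappa set, and it lies in the fibre over [q] once the
    set of coordinates is closed under [cylinder_refine]. *)
Lemma homogeneous_Gpoint p q (j0 : J) (h k : {ptws J -> X} -> {ptws J -> X}) :
  Gset T [set p] -> continuous h -> continuous k -> cancel h k -> cancel k h ->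
  h (fun=> p) = (fun=> q) -> Gset T [set q].
Proof.
move=> Gp ch ck hK kK hpq; pose f z : X := h z j0.
have cf : continuous f.
  move=> z; exact: (continuous_comp (ch z) (@ptws_proj_continuous J X j0 (h z))).
have /choice[c cP] (A : set J) : exists xA : {ptws J -> X} * set J,
    A #<= [set: T] -> [/\ cylinder p A xA.1, A `<=` xA.2, xA.2 #<= [set: T]
      & forall z : {ptws J -> X}, (forall j, xA.2 j -> z j = xA.1 j) -> f z = f xA.1].
  have [AT|nAT] := pselect (A #<= [set: T]); last by exists (fun=> p, set0).
  by have [x [A' xA]] := cylinder_refine p cf AT; exists (x, A').
pose A n := iter n (fun B => (c B).2) set0; pose x n := (c (A n)).1.
have AT n : A n #<= [set: T].
  by elim: n => [|n IHn]; [exact: card_ge0|case: (cP _ IHn)].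
have Amono m n : m <= n -> A m `<=` A n.
  elim: n => [|n IHn]; first by rewrite leqn0 => /eqP ->.
  rewrite leq_eqVlt => /orP[/eqP ->//|]; rewrite ltnS => /IHn.
  by move=> /subset_trans; apply; case: (cP _ (AT n)).
have xA n j : A n j -> x n j = p by have [xA _ _ _] := cP _ (AT n); exact: xA.
have fx n (z : {ptws J -> X}) : (forall j, A n.+1 j -> z j = x n j) -> f z = f (x n).
  by have [_ _ _] := cP _ (AT n); exact.
pose Aw := \bigcup_n A n.
(* Every [y] equal to [p] on [Aw] has the same sequence [f (x n)] converging to
   its value, witnessed by mixing [x n] on [Aw] with [y] elsewhere. *)
have lim (y : {ptws J -> X}) (U : set X) : cylinder p Aw y -> open U -> U (f y) ->
    exists N, forall n, N <= n -> U (f (x n)).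
  move=> yA oU Uy.
  have [|s fs sU] := @ptws_nbhs_support J X y (f @^-1` U).
    by apply/cf/open_nbhs_nbhs.
  have [N AN] : exists N, s `&` Aw `<=` A N.
    have /(@finite_seqP {classic J})[r ->] := fs.
    elim: r => [|j r [N AN]]; first by exists 0 => j [].
    have [[n _ Anj]|nAj] := pselect (Aw j).
      exists (maxn N n) => i [/=]; rewrite inE => /orP[/eqP ->|ri Awi].
        by move=> _; apply: Amono Anj; exact: leq_maxr.
      by apply: Amono (AN i _); [exact: leq_maxl|].
    exists N => i [/=]; rewrite inE => /orP[/eqP -> //|ri Awi].
    exact: AN.
  exists N => n Nn.
  pose z : {ptws J -> X} := fun j => if `[< Aw j >] then x n j else y j.
  rewrite -(fx n z) => [|j Aj]; last first.
    by rewrite /z asboolT //; exists n.+1.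
  apply: sU => j sj; rewrite /z; case: asboolP => // Awj.
  by rewrite yA // xA //; apply: Amono Nn _ _; exact: AN.
have fAw (y : {ptws J -> X}) : cylinder p Aw y -> f y = q.
  move=> yA; apply: contrapT => nyq.
  have fp : f (fun=> p) = q by rewrite /f hpq.
  have [U [V [oU oV Uy Vq UV]]] := separating_open hX nyq.
  have [N NU] := lim y U yA oU Uy.
  have [|||M MV] := lim (fun=> p) V => //; first by rewrite fp.
  have : (U `&` V) (f (x (maxn N M))).
    by split; [apply: NU; exact: leq_maxl|apply: MV; exact: leq_maxr].
  by rewrite UV.
(* The slice of the power through the constant function [q] in direction [j0]. *)
pose e (y : X) : {ptws J -> X} := @dfwith {classic J} (fun=> X) (fun=> q) j0 y.
have ce : continuous e by exact: (@dfwith_continuous {classic J} (fun=> X)).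
rewrite (_ : [set q] = e @^-1` (k @^-1` cylinder p Aw)).
  apply: Gset_preimage => //; apply: Gset_preimage => //.
  apply: Gset_cylinder => //; apply: (card_le_bigcup TT) => // n _.
apply/seteqP; split=> [_ -> | y /fAw].
  have eq : e q = (fun=> q).
    apply/funext => j; have [->|nj] := @eqVneq {classic J} j j0.
      by rewrite /e dfwithin.
    by rewrite /e dfwithout // eq_sym.
  by rewrite /preimage/= eq -hpq hK.
by rewrite /f kK /e => <-; rewrite dfwithin.
Qed.

End PowerHomogeneous.

(** * Arhangel'skii's bound *)

(** Terms built from operations of arity [E], labelled by [L]. They index the
    closure of a point under such operations, and their number is bounded
    without ordinals: a term is determined by the labels met along the finite
    paths from its root. *)
Inductive tree (L E : Type) := Leaf | Node of L & (E -> tree L E).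
Arguments Leaf {L E}.

Fixpoint tree_code (L E : Type) (w : tree L E) (s : seq E) : option L :=
  if w is Node l c then
    if s is e :: s' then tree_code (c e) s' else Some l
  else None.

Lemma tree_code_inj (L E : Type) : injective (@tree_code L E).
Proof.
elim=> [|l c IHc] [|l' c'] // e.
- by have := congr1 (@^~ [::]) e.
- by have := congr1 (@^~ [::]) e.
have /= [->] := congr1 (@^~ [::]) e; congr Node; apply/funext => a.
by apply: IHc; apply/funext => s; exact: (congr1 (@^~ (a :: s)) e).
Qed.

Section CardinalityBound.
Variables (T : pointedType) (X : topologicalType).
Hypothesis natT : [set: nat] #<= [set: T].
Hypothesis TT : [set: T * T] #<= [set: T].
Hypothesis hX : hausdorff_space X.
Hypothesis cX : compact [set: X].

Lemma Gpoint_nbhs_family (z : X) : Gset T [set z] ->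
  exists O : T -> set X, (forall t, open (O t) /\ O t z) /\
    forall y, (forall t, closure (O t) y) -> y = z.
Proof.
move=> [F [/pcard_injP[code cinj] oF zF]].
have /choice[O OP] (t : T) : exists O : set X, [/\ open O, O z
    & forall U, F U -> code U = t -> closure O `<=` U].
  have [[U [FU Ut]]|nt] := pselect (exists U, F U /\ code U = t); last first.
    by exists setT; split=> // [|U FU Ut]; [exact: openT|case: nt; exists U].
  have Uz : U z by have : [set z] z by []; rewrite zF; exact.
  have [O [oO Oz OU]] := shrink_open hX cX (oF U FU) Uz.
  exists O; split=> // V FV; rewrite -Ut => /cinj -> //; exact/mem_set.
exists O; split=> [t|y yO]; first by case: (OP t).
suff : [set z] y by [].
by rewrite zF => U FU; have [_ _ /(_ U FU erefl)] := OP (code U); exact.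
Qed.

Hypothesis GX : forall z : X, Gset T [set z].

(** Convergence along the finite subsets of [T]; closures are captured by these
    nets alone, because neighbourhoods of a G_kappa point in a compactum are
    generated by kappa many. *)
Definition tends (g : seq T -> X) (z : X) := forall U, open U -> U z ->
  exists s0 : seq T, forall s, {subset s0 <= s} -> U (g s).

Lemma tends_unique g y z : tends g y -> tends g z -> y = z.
Proof.
move=> gy gz; apply: contrapT => /(separating_open hX)[U [V [oU oV Uy Vz UV]]].
have [r rU] := gy U oU Uy; have [s sV] := gz V oV Vz.
have : (U `&` V) (g (r ++ s)).
  by split; [apply: rU|apply: sV] => i; rewrite mem_cat => ->; rewrite ?orbT.
by rewrite UV.
Qed.

(** Choose [g s] in [H] and in the neighbourhoods of [z] indexed by [s]. By
    compactness, finitely many closed neighbourhoods of the family fit in any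
    given open neighbourhood of [z]. *)
Lemma closure_tends (H : set X) z : closure H z ->
  exists2 g, (forall s, H (g s)) & tends g z.
Proof.
move=> Hz; have [O [OP Oz]] := Gpoint_nbhs_family (GX z).
have /choice[g gP] (s : seq T) : exists x, H x /\ forall t, t \in s -> O t x.
  have [|x [Hx Ox]] := Hz (\bigcap_(t in [set` s]) O t); last by exists x.
  elim: s => [|t s IHs]; first by apply: filterS filterT => x _ i.
  have Ot : nbhs z (O t) by apply: open_nbhs_nbhs; exact: OP.
  apply: filterS (filterI Ot IHs) => x [Ox Osx] i /=.
  by rewrite inE => /orP[/eqP->//|si]; exact: Osx.
exists g => [s|U oU Uz]; first by case: (gP s).
have cU : compact (~` U) by apply: subclosed_compact cX _ => //; exact: open_closedC.
have [t _|y Uy|s _ sU] := @compact_finite_cover X T (~` U) setT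
    (fun t => ~` closure (O t)) cU.
- exact/closed_openC/closed_closure.
- apply: contrapT => ny; apply: Uy; rewrite (Oz y) // => t.
  by apply: contrapT => nOy; apply: ny; exists t.
exists s => r sr; apply: contrapT => /sU[t ts]; apply; apply: subset_closure.
by have [_] := gP r; apply; exact: sr.
Qed.

(** Let [H] be the closure of a point under two kinds of operations: limits of
    nets, and choosing a point outside a finite union of the neighbourhoods
    [O x t] with [x] in [H]. Then [H] is closed, hence compact. If it missed a
    point [z], finitely many [O x t] missing [z] would cover [H], and the
    point chosen outside their union would be in [H]. So [H] is the whole
    space, and it is the image of a set of at most 2^kappa terms. *)
Lemma card_le_compact_Gpoints : [set: X] #<= [set: set T].
Proof.
have [[x0 _]|X0] := pselect ([set: X] !=set0); last first.
  suff -> : [set: X] = set0 by exact: card_ge0.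
  by apply: contrapT => /eqP/set0P.
have /choice[O OP] z := Gpoint_nbhs_family (GX z).
pose L := option (seq (seq T * T)).
pose cover (s : seq (seq T * T)) (g : seq T -> X) : set X :=
  [set x | exists2 et, et \in s & O (g et.1) et.2 x].
pose eval := fix eval (w : tree L (seq T)) : X :=
  if w is Node l c then
    if l is Some s then xget x0 (~` cover s (eval \o c))
    else xget x0 [set z | tends (eval \o c) z]
  else x0.
pose H := range eval.
have branch (g : seq T -> X) : (forall s, H (g s)) -> exists c, g = eval \o c.
  move=> Hg; have /choice[c cP] s : exists w, eval w = g s.
    by have [w _ <-] := Hg s; exists w.
  by exists c; apply/funext => s; rewrite /= cP.
have closedH : closed H.
  move=> z /closure_tends[g /branch[c ->] cz]; exists (Node None c) => //=.
  exact: tends_unique (xgetI x0 cz) cz.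
have compactH : compact H by exact: subclosed_compact cX _.
have HT : H = setT.
  apply/seteqP; split=> // z _; apply: contrapT => nHz.
  pose P : set (X * T) := [set xt | H xt.1 /\ ~ O xt.1 xt.2 z].
  have [xt _|x Hx|r rP rcov] := @compact_finite_cover X (X * T)%type H P
      (fun xt => O xt.1 xt.2) compactH.
  - by case: (OP xt.1) => /(_ xt.2)[].
  - have [Ox xO] := OP x; apply: contrapT => nx; apply: nHz; rewrite (xO z) // => t.
    apply: subset_closure; apply: contrapT => nOz; apply: nx.
    by exists (x, t) => //; case: (Ox t).
  (* The [i]-th element of [r] is passed to the operation as the argument of
     index [nseq i point], a sequence identified by its size. *)
  pose g (s : seq T) := (nth (x0, point : T) r (size s)).1.
  have Hg s : H (g s).
    rewrite /g; have [sr|rs] := ltnP (size s) (size r).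
      by have [] := rP _ (mem_nth (x0, point : T) sr).
    by rewrite nth_default //; exists Leaf.
  have [c gc] := branch g Hg.
  pose l := [seq (nseq i (point : T), (nth (x0, point : T) r i).2) | i <- iota 0 (size r)].
  have coverH x : H x -> cover l g x.
    move=> /rcov[xt xtr Ox].
    exists (nseq (index xt r) (point : T), xt.2); last by rewrite /g size_nseq /= nth_index.
    apply/mapP; exists (index xt r); last by rewrite nth_index.
    by rewrite mem_iota /= add0n index_mem.
  have nz : (~` cover l g) z.
    move=> [_ /mapP[i + ->]] /=; rewrite mem_iota add0n /g size_nseq => /andP[_ ir].
    by have [_] := rP _ (mem_nth (x0, point : T) ir).
  have : H (eval (Node (Some l) c)) by exists (Node (Some l) c).
  by move=> /coverH; rewrite gc /= -gc; exact: (xgetI x0 nz).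
rewrite -HT; apply: (card_le_trans (card_image_le _ _)).
apply: (card_le_trans (card_le_inj (@tree_code_inj L (seq T)))).
have seqT : [set: seq T] #<= [set: T] by apply: card_le_seq => //; exact: card_lexx.
apply: card_le_fun => //; first exact: card_le_seq.
do 2!apply: card_le_option => //; apply: card_le_seq => //.
by apply: card_le_prod => //; exact: card_lexx.
Qed.

End CardinalityBound.

(** * The theorem *)

Lemma dis_family (X : topologicalType) (I : Type) : [set: X] !=set0 ->
  dis X #<= [set: I] ->
  exists D : I -> set X, (forall i, discrete_set (D i)) /\ \bigcup_i D i = setT.
Proof.
move=> [x _]; have [[disD disU] _] := disP X.
move=> /pfcard_geP[dis0|/surjfunPex[D disE]].
  have : (\bigcup_(A in dis X) A) x by rewrite disU.
  by rewrite dis0 bigcup_set0.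
exists D; split=> [i|]; first by apply: disD; rewrite disE; exists i.
by rewrite -disU disE bigcup_image.
Qed.

(** Here kappa is the cardinality of [beth k], so that [beth k.+1] is
    both kappa^+ and 2^kappa. *)
Lemma power_homogeneous_card_le (k : nat) (X : topologicalType) :
  GCH -> compact [set: X] -> hausdorff_space X -> [set: X] !=set0 ->
  power_homogeneous X -> dis X #<= [set: beth k.+1] ->
  [set: X] #<= [set: beth k.+1].
Proof.
move=> gch cX hX X0 [J [[j0] hom]] disk.
have [I [lt [wf ltT lttot small Ibig]]] := small_segments_wellorder k gch.
have [D [dD covD]] := dis_family X0 (card_le_trans disk Ibig).
have natT := card_nat_beth k; have TT := card_beth_square k.
rewrite /=; case: (beth_pointed k) => T Te; rewrite -{}Te in small natT TT *.
have GK (K : set X) : closed K -> K !=set0 ->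
    exists x G, Gset T G /\ K `&` G = [set x].
  exact: (discrete_cover_Gpoint natT TT hX cX wf ltT lttot small dD covD).
apply: card_le_compact_Gpoints => // q.
have [//|p [G [GG]]] := GK setT closedT; rewrite setTI => pG.
rewrite {}pG in GG.
have [h [k' [ch ck hK kK hpq]]] := hom (fun=> p) (fun=> q).
exact: (homogeneous_Gpoint natT TT hX cX GK j0 GG ch ck hK kK hpq).
Qed.

Unset Implicit Arguments.

Theorem theorem2p28 (X : topologicalType) :
  GCH ->
  [set: X] !=set0 ->
  compact [set: X] ->
  hausdorff_space X ->
  power_homogeneous X ->
  card_min (Delta X) aleph_omega #<= dis X.
Proof.
move=> gch X0 cX hX homX; apply/card_minP; have [_ Deltamin] := DeltaP X0.
have [disw|/(GCH_lt_aleph_omega gch)[disN|[k disk]]] :=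
  pselect (aleph_omega #<= dis X); first by right.
  left; have [D [dD covD]] := dis_family X0 disN.
  have [x ox] := countable_discrete_cover hX cX X0 dD covD.
  apply: (card_le_trans (Deltamin [set x] _)); first by split=> //; exists x.
  have [[_ disU] _] := disP X.
  have [A disA _] : (\bigcup_(A in dis X) A) x by rewrite disU.
  rewrite (card_le_eql (eq_card1 x A)); apply: subset_card_le => _ -> //.
left; apply: (card_le_trans (Deltamin setT _)); first by split=> //; exact: openT.
rewrite (card_le_eqr disk); apply: power_homogeneous_card_le => //.
by move: disk; rewrite card_eq_le => /andP[].
Qed.
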